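(* Let $A$ be a ring. Let $B$ be an $A$-algebra. Let $(I_\rho)_{\rho\in\mathbb{N}}$ be an ideal semifiltration of $A$. Let $n\in\mathbb{N}$. Let $u\in B$. Consider the polynomial ring $A[Y]$ and its $A$-subalgebra $A[(I_\rho)_{\rho\in\mathbb{N}}\ast Y]$ (the Rees algebra of the semifiltration). Then the element $u$ of $B$ is $n$-integral over $\left(A,(I_\rho)_{\rho\in\mathbb{N}}\right)$ if and only if the element $uY$ of the polynomial ring $B[Y]$ is $n$-integral over the ring $A[(I_\rho)_{\rho\in\mathbb{N}}\ast Y]$.
   Context: All rings are commutative with unity, and ''$A$-algebra'' means commutative unital $A$-algebra (the structure map $A\to B$ need not be injective). $\mathbb{N}=\{0,1,2,\ldots\}$. For a ring $A$, an $A$-algebra $B$ and $n\in\mathbb{N}$, an element $u\in B$ is called $n$-integral over $A$ if there exists a monic polynomial $P\in A[X]$ with $\deg P=n$ (that is, $P=X^n+\sum_{k=0}^{n-1}a_kX^k$ with $a_k\in A$) and $P(u)=0$. An ideal semifiltration of a ring $A$ is a sequence $(I_\rho)_{\rho\in\mathbb{N}}$ of ideals of $A$ such that $I_0=A$ and $I_aI_b\subseteq I_{a+b}$ for all $a,b\in\mathbb{N}$. Given an ideal semifiltration $(I_\rho)_{\rho\in\mathbb{N}}$ of $A$, an element $u$ of an $A$-algebra $B$ is called $n$-integral over $(A,(I_\rho)_{\rho\in\mathbb{N}})$ if there exists $(a_0,a_1,\ldots,a_n)\in A^{n+1}$ such that $\sum_{k=0}^{n}a_ku^k=0$, $a_n=1$,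 and $a_i\in I_{n-i}$ for every $i\in\{0,1,\ldots,n\}$. The Rees algebra $A[(I_\rho)_{\rho\in\mathbb{N}}\ast Y]$ is the subset $\sum_{i\in\mathbb{N}}I_iY^i$ of $A[Y]$, i.e. the set of all polynomials $P\in A[Y]$ whose $i$-th coefficient lies in $I_i$ for every $i\in\mathbb{N}$; it is an $A$-subalgebra of $A[Y]$. The polynomial ring $B[Y]$ is an $A[Y]$-algebra via the ring homomorphism $A[Y]\to B[Y]$ induced by the structure map $A\to B$, and hence an $A[(I_\rho)_{\rho\in\mathbb{N}}\ast Y]$-algebra by restriction. *)

(* Defs.v *)
From HB Require Import structures.
From mathcomp Require Import all_boot all_order all_algebra.
From mathcomp Require Import boolp classical_sets functions cardinality fsbigop.
Set Implicit Arguments.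
Unset Strict Implicit.
Unset Printing Implicit Defensive.
Import GRing.Theory.
Local Open Scope classical_set_scope.
Local Open Scope ring_scope.

(* Univariate polynomials over a commutative ring that may be the zero ring.
   MathComp's {poly R} requires 1 != 0 in R (and so do comAlgType and idealr),
   whereas rings here are only assumed commutative with unity; hence
   comPzRingType throughout, polynomials as finitely supported coefficient
   functions nat -> R, and A-algebras as ring morphisms {rmorphism A -> B}. *)
Section Pzpoly.
Variable R : comPzRingType.
Implicit Types f g : nat -> R.

Definition finsupp_pred : {pred nat -> R} :=
  fun f => `[< exists N, forall i, (N <= i)%N -> f i = 0 >].

Lemma finsupp_zmod_closed : zmod_closed finsupp_pred.
Proof.
split=> [|f g /asboolP[M fM] /asboolP[N gN]]; apply/asboolP; first by exists 0.
exists (maxn M N) => i; rewrite geq_max => /andP[Mi Ni].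
by rewrite /GRing.add /GRing.opp /= fM // gN // subr0.
Qed.

Record pzpoly := Pzpoly { coefs :> nat -> R; _ : coefs \in finsupp_pred }.
HB.instance Definition _ := [isSub for coefs].
HB.instance Definition _ := [Choice of pzpoly by <:].
HB.instance Definition _ :=
  GRing.SubChoice_isSubZmodule.Build _ finsupp_pred pzpoly finsupp_zmod_closed.

Implicit Types p q r : pzpoly.

Lemma pzpolyP p q : (forall i, p i = q i) <-> p = q.
Proof. by split=> [pq|-> //]; apply/val_inj/funext. Qed.

Lemma pzpoly_supp p : exists N, forall i, (N <= i)%N -> p i = 0.
Proof. by apply/asboolP; case: p. Qed.

Lemma pzcoef0 i : (0 : pzpoly) i = 0.
Proof. by []. Qed.

Lemma pzcoefN p i : (- p) i = - p i.
Proof. by []. Qed.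

Lemma pzcoefD p q i : (p + q) i = p i + q i.
Proof. by []. Qed.

Lemma pzpolyC_subproof (c : R) :
  (fun i => if i == 0 then c else 0) \in finsupp_pred.
Proof. by apply/asboolP; exists 1 => -[]. Qed.
Definition pzpolyC c := Pzpoly (pzpolyC_subproof c).

Lemma pzpolyX_subproof : (fun i => (i == 1)%:R : R) \in finsupp_pred.
Proof. by apply/asboolP; exists 2 => -[|[]]. Qed.
Definition pzpolyX := Pzpoly pzpolyX_subproof.

Lemma pzmul_subproof p q :
  (fun n => \sum_(i < n.+1) p i * q (n - i)%N) \in finsupp_pred.
Proof.
have [[M pM] [N qN]] := (pzpoly_supp p, pzpoly_supp q).
apply/asboolP; exists (M + N)%N => n MNn; rewrite big1 // => -[i /= ltin] _.
have [Mi|iM] := leqP M i; first by rewrite pM // mul0r.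
by rewrite qN ?mulr0 // leq_subRL // (leq_trans _ MNn) // leq_add2r ltnW.
Qed.
Definition pzmul p q := Pzpoly (pzmul_subproof p q).

Lemma pzmulC : commutative pzmul.
Proof.
move=> p q; apply/pzpolyP => n /=; rewrite (reindex_inj rev_ord_inj) /=.
by apply: eq_bigr => i _; rewrite mulrC (sub_ordK i).
Qed.

Lemma pzmulA : associative pzmul.
Proof.
have rev p q n : pzmul p q n = \sum_(j < n.+1) p (n - j)%N * q j.
  by rewrite pzmulC; apply: eq_bigr => i _; rewrite mulrC.
move=> p q r; apply/pzpolyP => i; rewrite [RHS]rev.
pose coef3 j k := p j * (q (i - j - k)%N * r k).
transitivity (\sum_(j < i.+1) \sum_(k < i.+1 | (k <= i - j)%N) coef3 j k).
  apply: eq_bigr => /= j _; rewrite -[X in _ * X]/(pzmul q r _) rev big_distrr.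
  by rewrite (big_ord_narrow_leq (leq_subr _ _)).
rewrite (exchange_big_dep predT) //=; apply: eq_bigr => k _.
transitivity (\sum_(j < i.+1 | (j <= i - k)%N) coef3 j k).
  apply: eq_bigl => j; rewrite -ltnS -(ltnS j) -!subSn ?leq_ord //.
  by rewrite -subn_gt0 -(subn_gt0 j) -!subnDA addnC.
rewrite (big_ord_narrow_leq (leq_subr _ _)) big_distrl /=.
by apply: eq_bigr => j _; rewrite /coef3 -!subnDA addnC mulrA.
Qed.

Lemma pzmul1 : left_id (pzpolyC 1) pzmul.
Proof.
move=> p; apply/pzpolyP => n /=.
by rewrite big_ord_recl big1 ?mul1r ?addr0 ?subn0 // => i _; rewrite mul0r.
Qed.

Lemma pzmulDl : left_distributive pzmul +%R.
Proof.
move=> p q r; apply/pzpolyP => n; rewrite pzcoefD /= -big_split.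
by apply: eq_bigr => i _; exact: mulrDl.
Qed.

HB.instance Definition _ :=
  GRing.Zmodule_isComPzRing.Build pzpoly pzmulA pzmulC pzmul1 pzmulDl.

Lemma pzcoef1 i : (1 : pzpoly) i = (i == 0)%:R.
Proof. by case: i. Qed.

Lemma pzcoefM p q n : (p * q) n = \sum_(i < n.+1) p i * q (n - i)%N.
Proof. by []. Qed.

(* The sum over all i : nat is finite because p is finitely supported. *)
Definition pzhorner p (x : R) : R := \sum_(i \in [set: nat]) p i * x ^+ i.

Lemma pzhornerE p x N : (forall i, (N <= i)%N -> p i = 0) ->
  pzhorner p x = \sum_(i < N) p i * x ^+ i.
Proof.
move=> pN; rewrite (fsbig_ord _ _ (fun i => p i * x ^+ i)).
apply/esym/(fsbig_widen `I_N) => // i [_ /= /negP Ni].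
by rewrite pN ?mul0r // leqNgt.
Qed.

(* P = X^n + \sum_(k < n) a_k X^k; over the zero ring this holds for all n. *)
Definition monic_of_deg n p : Prop :=
  p n = 1 /\ forall k, (n < k)%N -> p k = 0.

End Pzpoly.

Section Map.
Variables (A B : comPzRingType) (f : {rmorphism A -> B}).

Lemma pzmap_subproof (p : pzpoly A) : f \o p \in @finsupp_pred B.
Proof.
have [N pN] := pzpoly_supp p.
by apply/asboolP; exists N => i Ni /=; rewrite pN // rmorph0.
Qed.
Definition pzmap p := Pzpoly (pzmap_subproof p).

Lemma pzmap_is_zmod_morphism : zmod_morphism pzmap.
Proof. by move=> p q; apply/pzpolyP => i; apply: rmorphB. Qed.
HB.instance Definition _ :=
  GRing.isZmodMorphism.Build (pzpoly A) (pzpoly B) pzmap pzmap_is_zmod_morphism.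

Lemma pzmap_is_monoid_morphism : monoid_morphism pzmap.
Proof.
split=> [|p q]; apply/pzpolyP => i.
  by rewrite -[LHS]/(f ((1 : pzpoly A) i)) !pzcoef1 rmorph_nat.
by rewrite /= rmorph_sum; apply: eq_bigr => j _; rewrite rmorphM.
Qed.
HB.instance Definition _ := GRing.isMonoidMorphism.Build
  (pzpoly A) (pzpoly B) pzmap pzmap_is_monoid_morphism.
End Map.

(* B is regarded as an A-algebra through f. *)
Definition n_integral (A B : comPzRingType) (f : {rmorphism A -> B})
    (n : nat) (u : B) : Prop :=
  exists P : pzpoly A, monic_of_deg n P /\ pzhorner (pzmap f P) u = 0.

Section Semifiltration.
Variable A : comPzRingType.

Definition is_ideal (J : set A) : Prop :=
  [/\ J 0, forall x y, J x -> J y -> J (x + y)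
    & forall a x, J x -> J (a * x)].

Definition ideal_mul (J K : set A) : set A :=
  [set x | exists2 s : seq (A * A),
     forall yz, yz \in s -> J yz.1 /\ K yz.2 & x = \sum_(yz <- s) yz.1 * yz.2].

Record ideal_semifiltration := IdealSemifiltration {
  sfilt :> nat -> set A;
  sfilt_ideal : forall i, is_ideal (sfilt i);
  sfilt0 : sfilt 0 = [set: A];
  sfilt_mul : forall a b, ideal_mul (sfilt a) (sfilt b) `<=` sfilt (a + b)
}.

Variable I : ideal_semifiltration.

Definition rees_pred : {pred pzpoly A} := fun P => `[< forall i, I i (P i) >].

Lemma rees_subring_closed : subring_closed rees_pred.
Proof.
split.
- apply/asboolP => -[|i]; first by rewrite sfilt0.
  by have [] := sfilt_ideal I i.+1.
- move=> p q /asboolP Ip /asboolP Iq; apply/asboolP => i.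
  have [_ ID IM] := sfilt_ideal I i.
  by rewrite pzcoefD pzcoefN -mulN1r; apply: ID => //; apply: IM.
- move=> p q /asboolP Ip /asboolP Iq; apply/asboolP => n.
  have [I0 ID _] := sfilt_ideal I n.
  rewrite pzcoefM; apply: (big_ind (I n)) => // -[i ltin] _ /=.
  have /= := @sfilt_mul I i (n - i); rewrite subnKC //; apply.
  exists [:: (p i, q (n - i)%N)]; last by rewrite big_seq1.
  by move=> yz; rewrite inE => /eqP ->.
Qed.

Record rees := Rees { rees_val :> pzpoly A; _ : rees_val \in rees_pred }.
HB.instance Definition _ := [isSub for rees_val].
HB.instance Definition _ := [Choice of rees by <:].
HB.instance Definition _ := GRing.SubChoice_isSubComPzRing.Build
  (pzpoly A) rees_pred rees rees_subring_closed.

Lemma pzpolyC_rees a : pzpolyC a \in rees_pred.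
Proof.
apply/asboolP => -[|i]; first by rewrite sfilt0.
by have [] := sfilt_ideal I i.+1.
Qed.

(* rees is A[I * Y]; B[Y] is an algebra over it through this morphism. *)
Definition rees_map (B : comPzRingType) (f : {rmorphism A -> B}) :
  {rmorphism rees -> pzpoly B} := pzmap f \o (val : rees -> pzpoly A).

Definition n_integral_sfilt (B : comPzRingType) (f : {rmorphism A -> B})
    (n : nat) (u : B) : Prop :=
  exists a : 'I_n.+1 -> A,
    [/\ \sum_(k < n.+1) f (a k) * u ^+ k = 0, a ord_max = 1
      & forall i : 'I_n.+1, I (n - i)%N (a i)].

End Semifiltration.

(* Main.v *)
Require Import Defs.
From HB Require Import structures.
From mathcomp Require Import all_boot all_order all_algebra.
From mathcomp Require Import boolp classical_sets.
Import GRing.Theory.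
Local Open Scope ring_scope.

(** Multiplying by [(uY)^k] shifts coefficients by [k] and scales them by [u^k].
    Hence a relation [sum_k P_k (uY)^k = 0] over the Rees algebra, read in
    degree [n] ([pzhorner_CX_coef]), is the relation
    [sum_k (P_k)_(n-k) u^k = 0] in [B], and the coefficient [(P_k)_(n-k)] lies in
    [I_(n-k)] by definition of the Rees algebra. This turns an integral equation
    for [uY] into one for [u]. Conversely, a relation [sum_k a_k u^k = 0] with
    [a_k] in [I_(n-k)] is homogenized by taking [P_k = a_k Y^(n-k)]: then every
    term [P_k (uY)^k] is concentrated in degree [n], where the sum is the given
    relation. *)

Section Coefficients.
Variable R : comPzRingType.
Implicit Types p q : pzpoly R.

Lemma pzcoefCM c p i : (pzpolyC c * p) i = c * p i.
Proof.
rewrite pzcoefM big_ord_recl subn0 big1 ?addr0 // => j _.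
by rewrite /= mul0r.
Qed.

Lemma pzcoefMX p i : (p * pzpolyX R) i = if i is j.+1 then p j else 0.
Proof.
rewrite mulrC pzcoefM big_ord_recl mul0r add0r.
case: i => [|i]; first by rewrite big_ord0.
rewrite big_ord_recl /= mul1r subSS subn0 big1 ?addr0 // => j _.
by rewrite mul0r.
Qed.

Lemma pzcoefMCXn p u k i :
  (p * (pzpolyC u * pzpolyX R) ^+ k) i =
  if (k <= i)%N then p (i - k)%N * u ^+ k else 0.
Proof.
elim: k i => [|k IHk] i; first by rewrite !expr0 !mulr1 subn0.
rewrite exprSr mulrA [_ * (_ * _)]mulrCA pzcoefCM pzcoefMX.
case: i => [|i]; first by rewrite mulr0.
rewrite IHk ltnS subSS; case: leqP => _; last by rewrite mulr0.
by rewrite mulrC -mulrA -exprSr.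
Qed.

Lemma pzcoef_sum (J : Type) (s : seq J) (F : J -> pzpoly R) i :
  (\sum_(j <- s) F j) i = \sum_(j <- s) F j i.
Proof. by elim/big_rec2: _ => // j _ y _ <-. Qed.

Lemma pzmonomial_subproof (c : R) m :
  (fun i => if i == m then c else 0) \in @finsupp_pred R.
Proof.
by apply/asboolP; exists m.+1 => i mi; rewrite gtn_eqF.
Qed.

Definition pzmonomial c m := Pzpoly (pzmonomial_subproof c m).

Lemma pzmonomial0 : pzmonomial 1 0 = 1.
Proof. by apply/pzpolyP => -[]. Qed.

(** Evaluation at [uY] commutes with taking coefficients in degree [i]: each
    coefficient polynomial [Q k] contributes only through degree [i - k]. *)
Lemma pzhorner_CX_coef (Q : pzpoly (pzpoly R)) u N i :
  (forall k, (N <= k)%N -> Q k = 0) ->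
  pzhorner Q (pzpolyC u * pzpolyX R) i =
  \sum_(k < N) if (k <= i)%N then Q k (i - k)%N * u ^+ k else 0.
Proof.
move=> /pzhornerE ->; rewrite pzcoef_sum.
by apply: eq_bigr => k _; exact: pzcoefMCXn.
Qed.

End Coefficients.

Section Homogenization.
Variables (A : comPzRingType) (I : ideal_semifiltration A).

Lemma pzmonomial_rees c m : I m c -> pzmonomial A c m \in rees_pred I.
Proof.
move=> Ic; apply/asboolP => i /=; case: eqP => [->//|_].
by have [] := sfilt_ideal I i.
Qed.

Variables (n : nat) (a : 'I_n.+1 -> A).
Hypothesis Ia : forall i : 'I_n.+1, I (n - i)%N (a i).

(** The [k]-th coefficient of the homogenization is [a_k Y^(n-k)], a member of the
    Rees algebra by [Ia]; [insub] turns [k <= n] into an index for [a]. *)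
Definition homog_coef (k : nat) : rees I :=
  if insub k is Some i then Rees (pzmonomial_rees _ _ (Ia i)) else 0.

Lemma homog_coef_ord (k : 'I_n.+1) :
  rees_val (homog_coef k) = pzmonomial A (a k) (n - k)%N.
Proof. by rewrite /homog_coef valK. Qed.

Lemma homog_coef_gt k : (n < k)%N -> homog_coef k = 0.
Proof. by move=> nk; rewrite /homog_coef insubF // ltnS leqNgt nk. Qed.

Lemma homog_subproof : homog_coef \in @finsupp_pred (rees I).
Proof. by apply/asboolP; exists n.+1; exact: homog_coef_gt. Qed.

Definition homog : pzpoly (rees I) := Pzpoly homog_subproof.

Lemma homog_monic : a ord_max = 1 -> monic_of_deg n homog.
Proof.
move=> an1; split; last exact: homog_coef_gt.
apply/val_inj; rewrite /= -[X in homog_coef X]/(val (@ord_max n)).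
by rewrite homog_coef_ord subnn an1 pzmonomial0.
Qed.

End Homogenization.

Theorem theorem2p11 (A B : comPzRingType) (phi : {rmorphism A -> B})
    (I : ideal_semifiltration A) (n : nat) (u : B) :
  n_integral_sfilt I phi n u <->
  n_integral (rees_map I phi) n (pzpolyC u * pzpolyX B).
Proof.
have coefE (P : pzpoly (rees I)) i : monic_of_deg n P ->
    pzhorner (pzmap (rees_map I phi) P) (pzpolyC u * pzpolyX B) i =
    \sum_(k < n.+1)
       if (k <= i)%N then phi (rees_val (P k) (i - k)%N) * u ^+ k else 0.
  move=> [_ P0]; apply: pzhorner_CX_coef => k nk.
  by rewrite /= P0 // rmorph0.
split=> [[a [sum0 an1 Ia]]|[P [Pmonic sum0]]].
  exists (homog _ _ _ _ Ia); have monic := homog_monic _ _ _ _ Ia an1; split=> //.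
  apply/pzpolyP => i; rewrite coefE // pzcoef0.
  have [->|i_neq_n] := eqVneq i n.
    rewrite -[RHS]sum0; apply: eq_bigr => k _.
    by rewrite leq_ord homog_coef_ord /= eqxx.
  (* Each term is supported in degree [(n - k) + k = n]. *)
  apply: big1 => k _; case: leqP => // ki.
  rewrite homog_coef_ord /= -(eqn_add2r k) !subnK ?leq_ord //.
  by rewrite (negbTE i_neq_n) rmorph0 mul0r.
exists (fun k => rees_val (P k) (n - k)%N); split=> [||i].
- have /pzpolyP/(_ n) := sum0; rewrite coefE // pzcoef0 => sumn0.
  by rewrite -[RHS]sumn0; apply: eq_bigr => k _; rewrite leq_ord.
- by case: Pmonic => /= -> _; rewrite subnn.
- by case: (P i) => p /= /asboolP.
Qed.
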